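(* If there exists a ring satisfying (NK), then there exist a simple right self-injective von Neumann regular ring $T$ which is of Type $\mathrm{II}_f$ or of Type $\mathrm{III}$, and a countable subring $B$ of $T$ such that $B$ is a local ring and $B$ satisfies (NK).
   Context: All rings are associative with unit. A right ideal is nil if all its elements are nilpotent; a ring satisfies the condition (NK) if it contains two nil right ideals whose sum is not nil. A ring is local if it has a unique maximal right ideal. A ring $R$ is von Neumann regular (VNR) if for every $x\in R$ there is $y$ with $x=xyx$; a VNR ring is abelian regular if all its idempotents are central. A ring is directly finite if $xy=1$ implies $yx=1$. For a right self-injective VNR ring $R$: an idempotent $e$ is abelian if $eRe$ is abelian regular, and directly finite if $eRe$ is directly finite. $R$ is of Type $\mathrm{II}$ if $R$ has no nonzero abelian idempotents and every nonzero right ideal of $R$ contains a nonzero directly finite idempotent; $R$ is of Type $\mathrm{II}_f$ if it is of Type $\mathrm{II}$ and directly finite; $R$ is of Type $\mathrm{III}$ if it contains no nonzero directly finite idempotent. *)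

(* Defs.v *)
From HB Require Import structures.
From mathcomp Require Import all_boot all_order all_algebra.
Set Implicit Arguments. Unset Strict Implicit. Unset Printing Implicit Defensive.
Import GRing.Theory.
Local Open Scope ring_scope.

Definition nilpotent_el (R : pzRingType) (x : R) : Prop := exists n : nat, x ^+ n = 0.

Definition right_ideal (R : pzRingType) (I : R -> Prop) : Prop :=
  I 0 /\ (forall x y, I x -> I y -> I (x + y)) /\ (forall x, I x -> I (- x)) /\
  (forall x r, I x -> I (x * r)).

Definition two_sided_ideal (R : pzRingType) (I : R -> Prop) : Prop :=
  right_ideal I /\ (forall r x, I x -> I (r * x)).

Definition nil_set (R : pzRingType) (I : R -> Prop) : Prop :=
  forall x, I x -> nilpotent_el x.

Definition sum_set (R : pzRingType) (I J : R -> Prop) : R -> Prop :=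
  fun z => exists x y, I x /\ J y /\ z = x + y.

Definition NK (R : pzRingType) : Prop :=
  exists I J : R -> Prop, right_ideal I /\ right_ideal J /\ nil_set I /\ nil_set J /\
    ~ nil_set (sum_set I J).

Definition maximal_right_ideal (R : pzRingType) (M : R -> Prop) : Prop :=
  right_ideal M /\ ~ M 1 /\
  forall N : R -> Prop, right_ideal N -> (forall x, M x -> N x) ->
    (forall x, N x <-> M x) \/ (forall x, N x).

Definition local_ring (R : pzRingType) : Prop :=
  exists M : R -> Prop, maximal_right_ideal M /\
    forall M' : R -> Prop, maximal_right_ideal M' -> forall x, M' x <-> M x.

Definition simple_ring (R : pzRingType) : Prop :=
  (1 : R) != 0 /\
  forall I : R -> Prop, two_sided_ideal I -> (forall x, I x <-> x = 0) \/ (forall x, I x).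

Definition VNR (R : pzRingType) : Prop := forall x : R, exists y, x = x * y * x.

Definition directly_finite (R : pzRingType) : Prop :=
  forall x y : R, x * y = 1 -> y * x = 1.

(* Right R-modules are left modules over the converse ring R^c:
   the right action is  v . r := r *: v. *)
Definition rlinear_to_R (R : pzRingType) (A : lmodType (R^c)) (f : A -> R) : Prop :=
  (forall a b, f (a + b) = f a + f b) /\ (forall (r : R) (a : A), f ((r : R^c) *: a) = f a * r).

Definition rlinear (R : pzRingType) (A B : lmodType (R^c)) (f : A -> B) : Prop :=
  (forall a b, f (a + b) = f a + f b) /\ (forall (r : R^c) (a : A), f (r *: a) = r *: f a).

Definition right_self_injective (R : pzRingType) : Prop :=
  forall (A B : lmodType (R^c)) (i : A -> B) (f : A -> R),
    rlinear i -> injective i -> rlinear_to_R f ->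
    exists g : B -> R, rlinear_to_R g /\ forall a, g (i a) = f a.

Definition idempotent (R : pzRingType) (e : R) : Prop := e * e = e.

Definition in_corner (R : pzRingType) (e x : R) : Prop := x = e * x * e.

Definition abelian_idempotent (R : pzRingType) (e : R) : Prop :=
  idempotent e /\
  (forall x, in_corner e x -> exists y, in_corner e y /\ x = x * y * x) /\
  (forall f, in_corner e f -> idempotent f -> forall x, in_corner e x -> f * x = x * f).

Definition directly_finite_idempotent (R : pzRingType) (e : R) : Prop :=
  idempotent e /\
  forall x y, in_corner e x -> in_corner e y -> x * y = e -> y * x = e.

Definition TypeII (R : pzRingType) : Prop :=
  (forall e : R, abelian_idempotent e -> e = 0) /\
  forall I : R -> Prop, right_ideal I -> (exists x, I x /\ x <> 0) ->
    exists e, I e /\ e <> 0 /\ directly_finite_idempotent e.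

Definition TypeII_f (R : pzRingType) : Prop := TypeII R /\ directly_finite R.

Definition TypeIII (R : pzRingType) : Prop :=
  forall e : R, directly_finite_idempotent e -> e = 0.

Definition countable_type (T : Type) : Prop := exists f : T -> nat, injective f.

(* Main.v *)
Require Import Defs.
From HB Require Import structures.
From mathcomp Require Import all_boot all_order all_algebra.
From mathcomp Require Import generic_quotient boolp classical_sets functions.
Set Implicit Arguments. Unset Strict Implicit. Unset Printing Implicit Defensive.
Import GRing.Theory.
Local Open Scope ring_scope.

(** Let x, y generate nil right ideals of R while z = x + y is not nilpotent. If some prime p is
    such that no power of z lies in pR, take F = F_p; otherwise no power of z is torsion and take
    F = Q. In both cases every power of z is sent to 1 by some additive map R -> F, so z acts
    non-nilpotently on the F-space of additive maps R -> F.

    Let V be a product of infinitely many copies of F, and let Q be the quotient of End(V) by the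
    ideal of the q for which a q b = 1 has no solution. In Q every nonzero q satisfies a q b = 1 for
    some a, b, and Q is not directly finite. Both properties pass to the maximal right quotient
    ring T of Q, which is therefore simple and of Type III, besides being right self-injective and
    von Neumann regular.

    The action of R above spreads over V and gives a non-unital homomorphism R -> Q which keeps z
    non-nilpotent. Let B be the F-subalgebra of Q generated by the images X, Y of x and y. Clearing
    denominators, XB and YB are nil, hence B = F + (XB + YB) with XB + YB quasi-regular, so B is
    local. *)

(** * Quotients by ring congruences *)

Section QuotientRing.
Variables (A : Type) (zero one : A) (opp : A -> A) (add mul : A -> A -> A).
Variable eqv : A -> A -> Prop.

Record ring_congruence : Prop := RingCongruence {
  eqv_refl : forall a, eqv a a;
  eqv_sym : forall a b, eqv a b -> eqv b a;
  eqv_trans : forall a b c, eqv a b -> eqv b c -> eqv a c;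
  eqv_opp : forall a b, eqv a b -> eqv (opp a) (opp b);
  eqv_add : forall a a' b b', eqv a a' -> eqv b b' -> eqv (add a b) (add a' b');
  eqv_mul : forall a a' b b', eqv a a' -> eqv b b' -> eqv (mul a b) (mul a' b');
  eqv_addA : forall a b c, eqv (add a (add b c)) (add (add a b) c);
  eqv_addC : forall a b, eqv (add a b) (add b a);
  eqv_add0 : forall a, eqv (add zero a) a;
  eqv_addN : forall a, eqv (add (opp a) a) zero;
  eqv_mulA : forall a b c, eqv (mul a (mul b c)) (mul (mul a b) c);
  eqv_mul1 : forall a, eqv (mul one a) a;
  eqv_1mul : forall a, eqv (mul a one) a;
  eqv_mulDl : forall a b c, eqv (mul (add a b) c) (add (mul a c) (mul b c));
  eqv_mulDr : forall a b c, eqv (mul a (add b c)) (add (mul a b) (mul a c)) }.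

(** The interface through which quotients are used: later arguments see only [p], never the choice
    of representatives. *)
Definition is_quotient_ring (T : pzRingType) (p : A -> T) : Prop :=
  (forall t, exists a, p a = t) /\ (forall a b, p a = p b <-> eqv a b) /\
  p zero = 0 /\ p one = 1 /\ (forall a, p (opp a) = - p a) /\
  (forall a b, p (add a b) = p a + p b) /\ (forall a b, p (mul a b) = p a * p b).

Section Construction.
Hypothesis cg : ring_congruence.

Definition carrier : Type := A.
HB.instance Definition _ := gen_eqMixin carrier.
HB.instance Definition _ := gen_choiceMixin carrier.

Definition eqvb (a b : carrier) := `[< eqv a b >].

Lemma eqvb_equiv : equiv_class_of eqvb.
Proof.
split=> [a|a b|b a c ab bc]; first exact/asboolP/(eqv_refl cg).
- by apply/idP/idP => /asboolP ab; apply/asboolP; apply: (eqv_sym cg ab).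
- apply/asboolP; exact: (eqv_trans cg (asboolW ab) (asboolW bc)).
Qed.

Canonical eqvb_equivRel := EquivRelPack eqvb_equiv.

Definition quotient := {eq_quot eqvb_equivRel}%qT.
HB.instance Definition _ := Choice.on quotient.

Definition proj (a : A) : quotient := \pi_quotient%qT (a : carrier).
Definition rep (t : quotient) : A := repr t.

Lemma projP a b : proj a = proj b <-> eqv a b.
Proof.
rewrite /proj; split; first by move/eqmodP/asboolP.
by move=> ab; apply/eqmodP/asboolP.
Qed.

Lemma repK t : proj (rep t) = t.
Proof. exact: reprK. Qed.

Lemma rep_proj a : eqv (rep (proj a)) a.
Proof. by apply/projP; rewrite repK. Qed.

Definition qopp t := proj (opp (rep t)).
Definition qadd s t := proj (add (rep s) (rep t)).
Definition qmul s t := proj (mul (rep s) (rep t)).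

Lemma qoppE a : qopp (proj a) = proj (opp a).
Proof. exact/projP/(eqv_opp cg)/rep_proj. Qed.
Lemma qaddE a b : qadd (proj a) (proj b) = proj (add a b).
Proof. by apply/projP/(eqv_add cg); apply: rep_proj. Qed.
Lemma qmulE a b : qmul (proj a) (proj b) = proj (mul a b).
Proof. by apply/projP/(eqv_mul cg); apply: rep_proj. Qed.

Lemma proj_surj t : exists a, t = proj a.
Proof. by exists (rep t); rewrite repK. Qed.

Ltac by_rep ax := repeat (let t := fresh in move=> t; have [? ->] := proj_surj t);
  rewrite ?(qoppE, qaddE, qmulE); apply/projP; exact: ax.

Fact qaddA : associative qadd. Proof. by_rep (eqv_addA cg). Qed.
Fact qaddC : commutative qadd. Proof. by_rep (eqv_addC cg). Qed.
Fact qadd0 : left_id (proj zero) qadd. Proof. by_rep (eqv_add0 cg). Qed.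
Fact qaddN : left_inverse (proj zero) qopp qadd.
Proof. by_rep (eqv_addN cg). Qed.
Fact qmulA : associative qmul. Proof. by_rep (eqv_mulA cg). Qed.
Fact qmul1 : left_id (proj one) qmul. Proof. by_rep (eqv_mul1 cg). Qed.
Fact q1mul : right_id (proj one) qmul. Proof. by_rep (eqv_1mul cg). Qed.
Fact qmulDl : left_distributive qmul qadd. Proof. by_rep (eqv_mulDl cg). Qed.
Fact qmulDr : right_distributive qmul qadd. Proof. by_rep (eqv_mulDr cg). Qed.

HB.instance Definition _ := GRing.isPzRing.Build quotient
  qaddA qaddC qadd0 qaddN qmulA qmul1 q1mul qmulDl qmulDr.

Lemma quotient_ring_proof : @is_quotient_ring quotient proj.
Proof.
split; first by move=> t; exists (rep t); rewrite repK.
split; first exact: projP.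
do 2?[split=> //]; split; first by move=> a; rewrite -qoppE.
by split=> a b; rewrite -?qaddE -?qmulE.
Qed.

End Construction.

Lemma quotient_ring : ring_congruence ->
  exists (T : pzRingType) (p : A -> T), is_quotient_ring p.
Proof. by move=> cg; exists (quotient cg), (proj cg); apply: quotient_ring_proof. Qed.

End QuotientRing.

(** * Maximal linear relations and Baer's criterion *)

(** Partial linear maps are handled through their graphs, which are submodules of the product of [B]
    and [E]; single-valuedness is the separate condition [functional]. The domain is then part of
    the relation. *)
Definition linrel (R : pzRingType) (B E : lmodType R) (G : B -> E -> Prop) : Prop :=
  G 0 0 /\ forall r b e b' e', G b e -> G b' e' -> G (r *: b + b') (r *: e + e').

Definition functional (B E : zmodType) (G : B -> E -> Prop) : Prop :=
  forall e, G 0 e -> e = 0.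

Section MaximalGraph.
Variables (R : pzRingType) (B E : lmodType R).
Implicit Types G C : B -> E -> Prop.

Lemma linrelZ G r b e : linrel G -> G b e -> G (r *: b) (r *: e).
Proof. by move=> [G0 GD] /GD/(_ G0)-/(_ r); rewrite !addr0. Qed.

Lemma linrelD G b e b' e' : linrel G -> G b e -> G b' e' -> G (b + b') (e + e').
Proof. by move=> [G0 GD] Gb /(GD 1 _ _ _ _ Gb); rewrite !scale1r. Qed.

Lemma linrelN G b e : linrel G -> G b e -> G (- b) (- e).
Proof. by move=> lG /(linrelZ (-1) lG); rewrite !scaleN1r. Qed.

Lemma linrelB G b e b' e' : linrel G -> G b e -> G b' e' -> G (b - b') (e - e').
Proof. by move=> lG Gb /(linrelN lG)/(linrelD lG Gb). Qed.

Lemma functionalP G b e e' : linrel G -> functional G -> G b e -> G b e' -> e = e'.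
Proof.
move=> lG fG Gb /(linrelB lG Gb); rewrite subrr => /fG/eqP.
by rewrite subr_eq0 => /eqP.
Qed.

Definition between G0 C G : Prop :=
  linrel G /\ functional G /\ (forall b e, G0 b e -> G b e) /\
  (forall b e, G b e -> C b e).

(** For a functional linear relation [G], this is the condition under which adjoining the pair (b,
    e) and its multiples keeps the graph single-valued. *)
Definition compatible G b e := forall r e', G (r *: b) e' -> e' = r *: e.

Lemma maximal_graph G0 C : linrel C -> between G0 C G0 ->
  exists G, between G0 C G /\ forall b e, C b e -> compatible G b e -> G b e.
Proof.
move=> lC G0btw.
(* [G0] is joined to every set, so that the union of the empty chain satisfies [P] as well. *)
pose ext (X : set (B * E)) b e := X (b, e) \/ G0 b e.
pose P (X : set (B * E)) := between G0 C (ext X).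
have [F FP Ftot|X [PX Xmax]] := @Zorn_bigcup _ P.
  (* Any two pairs in the union of a chain already lie in one admissible graph, which is [G0] or
     comes from a member of the chain; closure under sums is checked there. *)
  have extU (p q : B * E) : ext (\bigcup_(Y in F) Y)%classic p.1 p.2 ->
      ext (\bigcup_(Y in F) Y)%classic q.1 q.2 ->
      exists2 H, between G0 C H & H p.1 p.2 /\ H q.1 q.2 /\
        forall b e, H b e -> ext (\bigcup_(Y in F) Y)%classic b e.
    have sub Y : F Y -> forall b e, ext Y b e -> ext (\bigcup_(Y in F) Y)%classic b e.
      by move=> FY b e [Yb|]; [left; exists Y|right].
    move: p q => [b e] [b' e'] /= [[Y FY Yb]|Gb] [[Z FZ Zb]|Gb'].
    - have [YZ|ZY] := Ftot _ _ FY FZ.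
        by exists (ext Z); [apply: FP|split; [left; apply: YZ|split; [left|apply: sub]]].
      by exists (ext Y); [apply: FP|split; [left|split; [left; apply: ZY|apply: sub]]].
    - by exists (ext Y); [apply: FP|split; [left|split; [right|apply: sub]]].
    - by exists (ext Z); [apply: FP|split; [right|split; [left|apply: sub]]].
    - by exists G0 => //; split=> //; split=> // b0 e0; right.
  split; [split|split; [|split]].
  - by right; case: G0btw => -[].
  - move=> r b e b' e' Gb Gb'; have [H [lH _] [Hb [Hb' HU]]] := extU (b, e) (b', e') Gb Gb'.
    by apply: HU; apply: (proj2 lH).
  - by move=> e Ge; have [H [_ [fH _]] [/fH]] := extU (0, e) (0, e) Ge Ge.
  - by right.
  - move=> b e Gb; have [H [_ [_ [_ HC]]] [Hb _]] := extU (b, e) (b, e) Gb Gb.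
    exact: HC.
case: (PX) => lG [fG [G0G GC]]; exists (ext X); split=> // b0 e0 C0 comp.
(* The graph spanned by [ext X] and (b0, e0); if the pair were missing, this would contradict
   maximality. *)
pose X' : set (B * E) := fun p =>
  exists r b e, ext X b e /\ p.1 = r *: b0 + b /\ p.2 = r *: e0 + e.
have X'X b e : ext X' b e -> X' (b, e).
  by case=> // /G0G Gb; exists 0, b, e; rewrite !scale0r !add0r.
have XX' b e : ext X b e -> X' (b, e).
  by move=> Gb; exists 0, b, e; rewrite !scale0r !add0r.
have X'0 : X' (b0, e0).
  by exists 1, 0, 0; rewrite !scale1r !addr0; split=> //; case: lG.
have PX' : P X'.
  split; [split|split; [|split]].
  - by left; apply: XX'; case: lG.
  - move=> r _ _ _ _ /X'X[s [b [e [Gb /=[-> ->]]]]] /X'X[s' [b' [e' [Gb' /=[-> ->]]]]].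
    left; exists (r * s + s'), (r *: b + b'), (r *: e + e'); split.
      exact: (proj2 lG).
    by rewrite /= !scalerDr !scalerDl !scalerA -!addrA; split; congr (_ + _); rewrite addrCA.
  - move=> y /X'X[r [b [e [Gb /=[/esym/eqP rb ->]]]]]; move: rb.
    rewrite addr_eq0 => /eqP rb.
    move: (linrelN lG Gb); rewrite -rb => /comp <-.
    by rewrite addNr.
  - by right.
  - move=> _ _ /X'X[r [b [e [Gb /=[-> ->]]]]]; apply: (proj2 lC) => //; exact: GC.
have [//|nX] := pselect (ext X b0 e0); exfalso; apply: (Xmax X' _ PX').
split=> [[b e] Xb|X'sub]; first by apply: XX'; left.
by apply: nX; left; apply: X'sub.
Qed.

Lemma total_graph G0 C : linrel C -> between G0 C G0 ->
    (forall G, between G0 C G -> forall b, exists e, C b e /\ compatible G b e) ->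
  exists g : B -> E, (forall r b b', g (r *: b + b') = r *: g b + g b') /\
    (forall b, C b (g b)) /\ (forall b e, G0 b e -> g b = e).
Proof.
move=> lC G0btw step; have [G [Gbtw Gmax]] := maximal_graph lC G0btw.
have /choice[g gG] b : exists e, G b e.
  by have [e [Cb Gb]] := step G Gbtw b; exists e; apply: Gmax.
case: (Gbtw) => lG [fG [G0G GC]]; exists g; split; last first.
  by split=> [b|b e /G0G Gb]; [apply: GC|apply: functionalP (gG b) Gb].
move=> r b b'; apply: (functionalP lG fG (gG _)); exact: (proj2 lG).
Qed.

End MaximalGraph.

(** * Baer's criterion for right self-injectivity *)

Section SelfInjective.
Variable S : pzRingType.

(** By Zorn it is enough to adjoin one element b to the domain of a partial extension. The scalars
    carrying b into the domain form a right ideal, and the criterion represents the induced map on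
    it by left multiplication by some s, which is a compatible value at b. *)
Lemma baer :
    (forall (I : S -> Prop) (g : S -> S), right_ideal I ->
       (forall x y, I x -> I y -> g (x + y) = g x + g y) ->
       (forall x r, I x -> g (x * r) = g x * r) ->
     exists s, forall x, I x -> g x = s * x) ->
  right_self_injective S.
Proof.
move=> criterion A B i f [iD iZ] inj_i [fD fZ].
have i0 : i 0 = 0 by apply: (addrI (i 0)); rewrite -iD !addr0.
have f0 : f 0 = 0 by apply: (addrI (f 0)); rewrite -fD !addr0.
pose E : lmodType S^c := (S^c)^o.
pose G0 (b : B) (e : E) := exists a, b = i a /\ e = f a.
have := @total_graph S^c B E G0 (fun _ _ => True).
case=> //.
- split; [split|split; [|split]] => //.
  + by exists 0; rewrite i0 f0.
  + move=> r _ _ _ _ [a [-> ->]] [a' [-> ->]]; exists (r *: a + a').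
    by rewrite iD fD iZ fZ.
  + by move=> _ [a [/esym a0 ->]]; rewrite (inj_i a 0) ?i0.
- move=> G [lG [fG [G0G _]]] b.
  pose I (r : S) := exists e, G ((r : S^c) *: b) e.
  have /choice[g gG] (r : S) : exists e : E, I r -> G ((r : S^c) *: b) e.
    (* Outside [I] the function takes the default value 0, which the criterion never looks at. *)
    by have [[e Ge]|nI] := pselect (I r); [exists e|exists 0].
  have [|||s gs] := criterion I g.
  + split; [|split; [|split]].
    * by exists 0; rewrite scale0r; case: lG.
    * by move=> x y [e Ge] [e' Ge']; exists (e + e'); rewrite scalerDl; apply: linrelD.
    * by move=> x [e Ge]; exists (- e); rewrite scaleNr; apply: linrelN.
    * by move=> x r [e Ge]; exists ((r : S^c) *: e); rewrite -scalerA; apply: linrelZ.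
  + move=> x y Ix Iy; apply: (functionalP lG fG (gG _ _)).
      by case: Ix Iy => e Ge [e' Ge']; exists (e + e'); rewrite scalerDl; apply: linrelD.
    by rewrite scalerDl; apply: linrelD; [|apply: gG..].
  + move=> x r Ix; apply: (functionalP lG fG (gG _ _)).
      by case: Ix => e Ge; exists ((r : S^c) *: e); rewrite -scalerA; apply: linrelZ.
    by rewrite -[(x * r : S^c) *: b]scalerA; apply: (linrelZ (r : S^c) lG); apply: gG.
  exists s; split=> // r e Ge.
  have Ir : I r by exists e.
  by rewrite -[RHS](gs r Ir); apply: (functionalP lG fG Ge); apply: gG.
move=> g [gL [_ gG0]]; exists g; split; last by move=> a; apply: gG0; exists a.
split=> [a b|r a]; first by rewrite -[a in LHS]scale1r gL scale1r.
have g0 : g 0 = 0.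
  by have := gL (-1) 0 0; rewrite scaleN1r addNr scaleN1r addNr.
by rewrite -[_ *: a]addr0 gL g0 addr0.
Qed.

End SelfInjective.

Lemma rmorphism_pack (R S : pzRingType) (h : R -> S) :
    (forall a b, h (a - b) = h a - h b) -> h 1 = 1 ->
    (forall a b, h (a * b) = h a * h b) ->
  exists i : {rmorphism R -> S}, forall a, i a = h a.
Proof.
move=> hB h1 hM.
pose ha := GRing.isZmodMorphism.Build R S h hB.
pose hm := GRing.isMonoidMorphism.Build R S h (conj h1 hM).
pose i : {rmorphism R -> S} := HB.pack h ha hm.
by exists i.
Qed.

Section RightIdeals.
Variables (R : pzRingType) (I : R -> Prop).
Hypothesis rI : right_ideal I.

Lemma right_ideal0 : I 0. Proof. by case: rI. Qed.
Lemma right_idealD x y : I x -> I y -> I (x + y).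
Proof. by case: rI => _ [D _]; apply: D. Qed.
Lemma right_idealN x : I x -> I (- x).
Proof. by case: rI => _ [_ [N _]]; apply: N. Qed.
Lemma right_idealM x r : I x -> I (x * r).
Proof. by case: rI => _ [_ [_ M]]; apply: M. Qed.
End RightIdeals.

(** * The maximal right quotient ring *)

Definition essential (Q : pzRingType) (D : Q -> Prop) : Prop :=
  right_ideal D /\ forall q, q <> 0 -> exists r, q * r <> 0 /\ D (q * r).

Definition right_linear_on (Q : pzRingType) (D : Q -> Prop) (f : Q -> Q) : Prop :=
  (forall a b, D a -> D b -> f (a + b) = f a + f b) /\
  (forall a r, D a -> f (a * r) = f a * r).

Definition right_nonsingular (Q : pzRingType) : Prop :=
  forall (D : Q -> Prop) q, essential D -> (forall d, D d -> q * d = 0) -> q = 0.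

Section Essential.
Variable Q : pzRingType.
Implicit Types (D : Q -> Prop) (f g : Q -> Q).

Lemma essentialT : essential (fun _ : Q => True).
Proof. by split=> // q q0; exists 1; rewrite mulr1. Qed.

Lemma essentialI D D' : essential D -> essential D' -> essential (fun q => D q /\ D' q).
Proof.
move=> [rD eD] [rD' eD']; split.
  split; [|split; [|split]].
  - by split; apply: right_ideal0.
  - by move=> x y [? ?] [? ?]; split; apply: right_idealD.
  - by move=> x [? ?]; split; apply: right_idealN.
  - by move=> x r [? ?]; split; apply: right_idealM.
move=> q /eD[r [/eD'[s [qrs D'qrs]] Dqr]]; exists (r * s); rewrite mulrA.
by do 2![split=> //]; apply: right_idealM.
Qed.

Lemma right_linear0 D f : right_ideal D -> right_linear_on D f -> f 0 = 0.
Proof. by move=> rD [_ fM]; rewrite -(mulr0 0) fM ?mulr0 //; apply: right_ideal0. Qed.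

Lemma right_linearN D f x : right_ideal D -> right_linear_on D f -> D x -> f (- x) = - f x.
Proof. by move=> rD [_ fM] Dx; rewrite -mulrN1 fM // mulrN1. Qed.

Hypothesis ns : right_nonsingular Q.

(** This is what makes the composite of two partial maps with essential domains again such a map. *)
Lemma essential_preim D g D' : essential D -> right_linear_on D g -> essential D' ->
  essential (fun q => D q /\ D' (g q)).
Proof.
move=> [rD eD] gL [rD' eD']; split.
  split; [|split; [|split]].
  - by split; rewrite ?(right_linear0 rD gL); apply: right_ideal0.
  - by move=> x y [? ?] [? ?]; rewrite (proj1 gL) //; split; apply: right_idealD.
  - by move=> x [? ?]; rewrite (right_linearN rD gL) //; split; apply: right_idealN.
  - by move=> x r [? ?]; rewrite (proj2 gL) //; split; apply: right_idealM.
move=> q /eD[r [qr Dqr]].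
(* These s form an essential right ideal, so by nonsingularity one of them does not annihilate the
   nonzero element q r. *)
pose D'' s := D' (g (q * r) * s).
have eD'' : essential D''.
  rewrite /D''; split.
    split; [|split; [|split]].
    - by rewrite mulr0; apply: right_ideal0.
    - by move=> x y Dx Dy; rewrite mulrDr; apply: right_idealD.
    - by move=> x Dx; rewrite mulrN; apply: right_idealN.
    - by move=> x s Dx; rewrite mulrA; apply: right_idealM.
  move=> s s0; have [gs|/eqP/eD'[t [gst D't]]] := eqVneq (g (q * r) * s) 0.
    by exists 1; rewrite mulr1 gs; split=> //; apply: right_ideal0.
  exists t; rewrite mulrA; split=> // st; apply: gst.
  by rewrite -mulrA st mulr0.
have [s [D''s qrs]] : exists s, D'' s /\ q * r * s <> 0.
  apply: contrapT => nex; apply: qr; apply: (ns eD'') => s D''s.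
  by apply: contrapT => qrs; apply: nex; exists s.
exists (r * s); rewrite mulrA; split=> //; split; first exact: right_idealM.
by rewrite (proj2 gL).
Qed.

(** Elements of the maximal right quotient ring are right linear maps defined on essential right
    ideals, identified when they agree on an essential right ideal. They are stored as total
    functions; the values outside the domain are arbitrary. *)
Definition germ := {f : Q -> Q | exists D, essential D /\ right_linear_on D f}.
Definition germ_eq (f g : germ) :=
  exists D, essential D /\ forall q, D q -> sval f q = sval g q.

Lemma germ_zero_proof : exists D, essential D /\ right_linear_on D (fun _ => 0).
Proof.
exists (fun _ => True); split; first exact: essentialT.
by split=> *; rewrite ?addr0 ?mul0r.
Qed.

Lemma germ_lmul_proof a : exists D, essential D /\ right_linear_on D (fun x => a * x).
Proof.
exists (fun _ => True); split; first exact: essentialT.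
by split=> *; rewrite ?mulrDr ?mulrA.
Qed.

Lemma germ_opp_proof (f : germ) : exists D, essential D /\ right_linear_on D (fun x => - sval f x).
Proof.
case: f => f [D [eD [fD fM]]] /=; exists D; split=> //.
by split=> [a b Da Db|a r Da]; rewrite ?fD ?fM // ?opprD ?mulNr.
Qed.

Lemma germ_add_proof (f g : germ) :
  exists D, essential D /\ right_linear_on D (fun x => sval f x + sval g x).
Proof.
case: f g => f [D [eD [fD fM]]] [g [D' [eD' [gD gM]]]] /=.
exists (fun q => D q /\ D' q); split; first exact: essentialI.
split=> [a b [Da Da'] [Db Db']|a r [Da Da']]; last by rewrite fM ?gM // mulrDl.
by rewrite fD ?gD // addrACA.
Qed.

Lemma germ_mul_proof (f g : germ) :
  exists D, essential D /\ right_linear_on D (fun x => sval f (sval g x)).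
Proof.
case: f g => f [D [eD [fD fM]]] [g [D' [eD' gL]]] /=.
exists (fun q => D' q /\ D (g q)); split; first exact: essential_preim.
by split=> [a b [Da Da'] [Db Db']|a r [Da Da']]; rewrite ?(proj1 gL) ?(proj2 gL) ?fD ?fM.
Qed.

Definition germ_zero : germ := exist _ _ germ_zero_proof.
Definition germ_lmul a : germ := exist _ _ (germ_lmul_proof a).
Definition germ_opp (f : germ) : germ := exist _ _ (germ_opp_proof f).
Definition germ_add (f g : germ) : germ := exist _ _ (germ_add_proof f g).
Definition germ_mul (f g : germ) : germ := exist _ _ (germ_mul_proof f g).

Lemma germ_eq_ext (f g : germ) : (forall q, sval f q = sval g q) -> germ_eq f g.
Proof. by move=> fg; exists (fun _ => True); split=> //; apply: essentialT. Qed.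

Lemma germ_ring : ring_congruence germ_zero (germ_lmul 1) germ_opp germ_add germ_mul germ_eq.
Proof.
split; try by move=> *; apply: germ_eq_ext => q;
  rewrite /= ?addrA ?add0r ?addNr ?mul1r //; rewrite addrC.
- by move=> f g [D [eD fg]]; exists D; split=> // q /fg.
- move=> f g h [D [eD fg]] [D' [eD' gh]]; exists (fun q => D q /\ D' q).
  by split=> [|q [/fg -> /gh]//]; apply: essentialI.
- by move=> f g [D [eD fg]]; exists D; split=> //= q /fg->.
- move=> f f' g g' [D [eD ff']] [D' [eD' gg']]; exists (fun q => D q /\ D' q).
  by split=> [|q [/ff' /= -> /gg' ->]//]; apply: essentialI.
- move=> f f' g g' [D [eD ff']] [D' [eD' gg']].
  case: (svalP g) => E [eE gL].
  exists (fun q => (E q /\ D (sval g q)) /\ D' q); split.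
    by apply: essentialI => //; apply: essential_preim.
  by move=> q [[_ /ff' /= ->] /gg' ->].
- move=> f g h; case: (svalP f) (svalP g) (svalP h) => [D [eD [fD _]]] [Dg [eDg gL]] [Dh [eDh hL]].
  exists (fun q => (Dg q /\ D (sval g q)) /\ (Dh q /\ D (sval h q))); split.
    by apply: essentialI; apply: essential_preim.
  by move=> q [[_ Dq] [_ Dq']] /=; rewrite fD.
Qed.

(** What is retained of the maximal right quotient ring: elements of [T] are fractions, they are
    determined on essential right ideals, and every partial map with essential domain is a left
    multiplication. *)
Definition dense_extension (T : pzRingType) (i : {rmorphism Q -> T}) : Prop :=
  (forall t, exists D, essential D /\ forall q, D q -> exists q', t * i q = i q') /\
  (forall t D, essential D -> (forall q, D q -> t * i q = 0) -> t = 0) /\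
  (forall D f, essential D -> right_linear_on D f ->
     exists t, forall q, D q -> t * i q = i (f q)).

Lemma max_quotient_ring :
  exists (T : pzRingType) (i : {rmorphism Q -> T}), injective i /\ dense_extension i.
Proof.
have [T [p [psurj [pE [p0 [p1 [pN [pD pM]]]]]]]] := quotient_ring germ_ring.
have [||a b|i iE] := @rmorphism_pack Q T (fun a => p (germ_lmul a)).
- move=> a b; rewrite -pN -pD; apply/pE/germ_eq_ext => q /=.
  by rewrite mulrDl mulNr.
- by [].
- by rewrite -pM; apply/pE/germ_eq_ext => q /=; rewrite mulrA.
(* For q in the domain, f (q x) = f(q) x for every x, so composing f with left multiplication by q
   gives left multiplication by f(q). *)
have mulE (f : germ) D q : right_linear_on D (sval f) -> D q -> p f * i q = i (sval f q).
  by move=> [_ fM] Dq; rewrite !iE -pM; apply/pE/germ_eq_ext => x /=; rewrite fM.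
have iinj : injective i.
  move=> a b; rewrite !iE => /pE[D [eD ab]]; apply/eqP; rewrite -subr_eq0.
  by apply/eqP/(ns eD) => d /ab /= abd; rewrite mulrBl abd subrr.
exists T, i; split=> //; split; [|split].
- move=> t; have [f <-] := psurj t; case: (svalP f) => D [eD fL].
  by exists D; split=> // q Dq; exists (sval f q); apply: mulE fL Dq.
- move=> t D eD; have [f <-] := psurj t; case: (svalP f) => D' [eD' fL] f0.
  rewrite -p0; apply/pE; exists (fun q => D q /\ D' q); split; first exact: essentialI.
  by move=> q [/f0]; rewrite -(rmorph0 i) => + D'q; rewrite (mulE _ _ _ fL D'q) => /iinj.
- move=> D f eD fL; have fP : exists D, essential D /\ right_linear_on D f by exists D.
  by exists (p (exist _ f fP)) => q Dq; apply: (mulE (exist _ f fP) D q fL Dq).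
Qed.

End Essential.

(** Division rings satisfy this too; direct infiniteness is a separate hypothesis where it
    matters. *)
Definition purely_infinite (Q : pzRingType) : Prop :=
  forall q : Q, q <> 0 -> exists x y, x * q * y = 1.

(** If q annihilates D and x q y = 1, essentiality gives a nonzero y r in D, while r = x (q (y r)) =
    0. *)
Lemma purely_infinite_nonsingular (Q : pzRingType) :
  purely_infinite Q -> right_nonsingular Q.
Proof.
move=> pi D q [rD eD] qD; apply: contrapT => q0; have [x [y xqy]] := pi q q0.
have y0 : y <> 0 by move=> y0; apply: q0; rewrite -(mul1r q) -xqy y0 mulr0 mul0r.
have [r [yr Dyr]] := eD y y0; apply: yr.
have r0 : r = 0 by rewrite -(mul1r r) -xqy -!mulrA (mulrA q) -(mulrA q) qD // mulr0.
by rewrite r0 mulr0.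
Qed.

(** * Injectivity, regularity and pure infiniteness of the maximal right quotient ring *)

Section DenseExtension.
Variables (Q T : pzRingType) (i : {rmorphism Q -> T}).
Hypotheses (inj_i : injective i) (dense_i : dense_extension i).

Let M : lmodType Q^c := (Q^c)^o.
Implicit Types G C : M -> M -> Prop.

Lemma dense_dom t : exists D, essential D /\ forall q, D q -> exists q', t * i q = i q'.
Proof. exact: (proj1 dense_i). Qed.

Lemma dense_eq s t D : essential D -> (forall q, D q -> s * i q = t * i q) -> s = t.
Proof.
move=> eD st; apply/eqP; rewrite -subr_eq0; apply/eqP.
by apply: (proj1 (proj2 dense_i)) eD _ => q Dq; rewrite mulrBl st ?subrr.
Qed.

(* A maximal extension of [G] has an essential domain. *)
Lemma extend_relation (G : Q -> Q -> Prop) : linrel (G : M -> M -> Prop) -> functional G ->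
  exists t, forall q q', G q q' -> t * i q = i q'.
Proof.
move=> lG fG.
have [//|//|H [[lH [fH [GH _]]] Hmax]] := @maximal_graph Q^c M M G (fun _ _ => True).
have HM (x x' r : Q) : H x x' -> H (x * r) (x' * r).
  by move=> Hx; exact: (@linrelZ Q^c M M H (r : Q^c) x x' lH Hx).
pose D (q : Q) := exists q' : Q, H q q'.
have /choice[f fH'] (q : Q) : exists q' : Q, D q -> H q q'.
  by have [[q' Hq]|nD] := pselect (D q); [exists q'|exists 0].
have rD : right_ideal D.
  split; [|split; [|split]].
  - by exists 0; case: lH.
  - by move=> x y [x' Hx] [y' Hy]; exists (x' + y'); apply: (linrelD lH).
  - by move=> x [x' Hx]; exists (- x'); apply: (linrelN lH).
  - by move=> x r [x' Hx]; exists (x' * r); apply: HM.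
have eD : essential D.
  split=> // q q0; apply: contrapT => nex; apply: q0.
  have qD (r : Q) : D (q * r) -> q * r = 0.
    by move=> Dqr; apply: contrapT => qr; apply: nex; exists r.
  (* The right ideal q Q meets the domain of [H] only in 0, so the pair (q, 0) is compatible with
     [H] and belongs to it by maximality. *)
  have Hq : H q 0.
    apply: Hmax => // r e' Hqr; rewrite scaler0; apply: fH.
    by rewrite -(qD r) //; exists e'.
  by rewrite -(mulr1 q); apply: qD; exists 0; rewrite mulr1.
have fL : right_linear_on D f.
  split=> [a b Da Db|a r Da]; apply: (functionalP lH fH).
  - exact/fH'/(right_idealD rD).
  - by apply: (linrelD lH); apply: fH'.
  - exact/fH'/(right_idealM rD).
  - by apply: HM; apply: fH'.
have [t tP] := proj2 (proj2 dense_i) D f eD fL.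
exists t => q q' /GH Hq; have Dq : D q by exists q'.
by rewrite tP // (functionalP lH fH (fH' q Dq) Hq).
Qed.

(** Baer's criterion applies: g is cut down to the elements of [Q] that lie in [I] and have their
    image in [Q], and some s extends this restriction. For x in [I], s x and g(x) agree on the
    essential right ideal of those q for which x q and g(x) q both come from [Q]. *)
Lemma dense_extension_self_injective : right_self_injective T.
Proof.
apply: baer => I g rI gD gM.
pose G (q q' : Q) := I (i q) /\ g (i q) = i q'.
have [||s sP] := @extend_relation G.
- split=> [|r b e b' e' [Ib gb] [Ib' gb']].
    rewrite /G !rmorph0; split; first exact: right_ideal0.
    by rewrite (right_linear0 rI (conj gD gM)).
  rewrite /G [i _]rmorphD [i (r *: b)]rmorphM; split.
    by apply: right_idealD => //; apply: right_idealM.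
  rewrite gD ?gM //; last exact: right_idealM.
  by rewrite gb gb' [RHS]rmorphD [i (r *: e)]rmorphM.
- move=> e [_]; rewrite rmorph0 (right_linear0 rI (conj gD gM)) -(rmorph0 i).
  by move/inj_i.
exists s => x Ix.
have [D [eD xD]] := dense_dom x; have [D' [eD' gxD]] := dense_dom (g x).
apply: (dense_eq (essentialI eD eD')) => q [/xD[a xq] /gxD[b gxq]].
rewrite gxq -mulrA xq (sP a b) //; split; rewrite -xq; first exact: right_idealM.
by rewrite gM.
Qed.

(* [y] extends a maximal partial section [a |-> b] of [b |-> s * b]; then [s * y * s] and [s]
   agree on the image of that section and on the kernel of [s]. *)
Lemma dense_extension_VNR : VNR T.
Proof.
move=> s; pose C (a b : Q) := s * i b = i a.
have lC : linrel (C : M -> M -> Prop).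
  split=> [|r a b a' b' ab ab']; first by rewrite /C !rmorph0 mulr0.
  rewrite /C !rmorphD /= [i (r *: b)]rmorphM [i (r *: a)]rmorphM.
  by rewrite mulrDr mulrA ab ab'.
have [//||G [[lG [fG [_ GC]]] Gmax]] :=
  @maximal_graph Q^c M M (fun a b => a = 0 /\ b = 0) C.
  split; [split|split; [|split]] => //.
  - by move=> r a b a' b' [-> ->] [-> ->]; rewrite !scaler0 !addr0.
  - by move=> e [].
  - by move=> a b [-> ->]; case: lC.
have [y yG] := extend_relation lG fG.
exists y; pose D q := s * i q = s * y * s * i q.
have rD : right_ideal D.
  rewrite /D; split; [|split; [|split]].
  - by rewrite !rmorph0 !mulr0.
  - by move=> a b Da Db; rewrite !rmorphD !mulrDr Da Db.
  - by move=> a Da; rewrite !rmorphN !mulrN Da.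
  - by move=> a r Da; rewrite !rmorphM !mulrA Da.
suff eD : essential D by apply: dense_eq eD _ => q.
split=> // q q0; have [E [[rE eE] sE]] := dense_dom s.
have {eE} [r [qr Eqr]] := eE q q0; have {sE} [a sa] := sE _ Eqr.
suff [u [qru Dqru]] : exists u, q * r * u <> 0 /\ D (q * r * u).
  by exists (r * u); rewrite mulrA.
move: (q * r) qr sa {Eqr} => w w0 sw.
have swE u : s * i (w * u) = i (a * u) by rewrite rmorphM mulrA sw -rmorphM.
have DE u : D (w * u) <-> i (a * u) = s * (y * i (a * u)).
  by rewrite /D -(mulrA (s * y)) swE mulrA.
(* Three cases: w Q meets the kernel of s; otherwise a Q meets the domain of the section
   nontrivially; otherwise maximality puts a itself in that domain. *)
have [[u [au wu]]|nker] := pselect (exists u, a * u = 0 /\ w * u <> 0).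
  by exists u; split=> //; apply/DE; rewrite au rmorph0 !mulr0.
have ker u : a * u = 0 -> w * u = 0.
  by move=> au; apply: contrapT => wu; apply: nker; exists u.
have [[u [au [b Gau]]]|ndom] := pselect (exists u, a * u <> 0 /\ exists b, G (a * u) b).
  exists u; split; first by move=> wu; apply: au; apply: inj_i; rewrite -swE wu !rmorph0 mulr0.
  by apply/DE; rewrite (yG _ _ Gau); symmetry; apply: GC.
(* If a u is in the domain of [G] then a u = 0, hence w u = 0; so (a, w) is compatible with [G]. *)
have Ga : G a w.
  apply: Gmax => // u e' Gau; have au : a * u = 0.
    by apply: contrapT => au; apply: ndom; exists u; split=> //; exists e'.
  by rewrite [RHS]ker //; apply: fG; rewrite -au.
exists 1; rewrite mulr1; split=> //.
by rewrite /D -!mulrA sw (yG _ _ Ga) -sw.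
Qed.

Hypothesis pi : purely_infinite Q.

Lemma dense_extension_purely_infinite : purely_infinite T.
Proof.
move=> s s0; have [D [eD sD]] := dense_dom s.
have [q [Dq sq]] : exists q, D q /\ s * i q <> 0.
  apply: contrapT => nex; apply: s0; apply: dense_eq eD _ => q Dq.
  by rewrite mul0r; apply: contrapT => sq; apply: nex; exists q.
have [q' sq'] := sD q Dq.
have [|x [y xqy]] := pi (q := q'); first by move=> q0; apply: sq; rewrite sq' q0 rmorph0.
by exists (i x), (i q * i y); rewrite mulrA -(mulrA (i x)) sq' -!rmorphM xqy rmorph1.
Qed.

End DenseExtension.

(** * Simplicity and Type III from pure infiniteness *)

Lemma purely_infinite_simple (T : pzRingType) :
  (1 : T) <> 0 -> purely_infinite T -> simple_ring T.
Proof.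
move=> one0 pi; split=> [|I [rI lI]]; first exact/eqP.
have [[x [Ix x0]]|nex] := pselect (exists x, I x /\ x <> 0).
  right=> y; have [a [b axb]] := pi x x0; rewrite -(mul1r y) -axb.
  by do 2!apply: right_idealM => //; apply: lI.
left=> x; split=> [Ix|->]; last exact: right_ideal0.
by apply: contrapT => x0; apply: nex; exists x.
Qed.

(** From x e y = 1 one gets u, v with u v = 1 and v u inside the corner of e. With k = e - v u, the
    map sending c to v c u + k is multiplicative and carries 1 to e, so it moves the pair a, b into
    the corner. Direct finiteness of e would give v b a u = v u, and multiplying by u on the left
    and v on the right would give b a = 1. *)
Lemma purely_infinite_typeIII (T : pzRingType) (a b : T) :
  purely_infinite T -> a * b = 1 -> b * a <> 1 -> TypeIII T.
Proof.
move=> pi ab ba e [ee df]; apply: contrapT => e0; have [x [y xey]] := pi e e0.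
pose u := x * e; pose v := e * y.
have uv : u * v = 1 by rewrite /u /v mulrA -(mulrA x) ee.
have ue : u * e = u by rewrite /u -mulrA ee.
have ev : e * v = v by rewrite /v mulrA ee.
clearbody u v; have [k kE] : exists k, k = e - v * u by exists (e - v * u).
have uk : u * k = 0 by rewrite kE mulrBr ue mulrA uv mul1r subrr.
have kv : k * v = 0 by rewrite kE mulrBl ev -mulrA uv mulr1 subrr.
have ke : k * e = k by rewrite kE mulrBl ee -mulrA ue.
have ek : e * k = k by rewrite kE mulrBr ee mulrA ev.
have kk : k * k = k by rewrite {2}kE mulrBr ke mulrA kv mul0r subr0.
have cE c : in_corner e (v * c * u + k).
  by rewrite /in_corner mulrDr mulrDl ek ke !mulrA ev -!mulrA ue.
have mE c d : (v * c * u + k) * (v * d * u + k) = v * (c * d) * u + k.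
  rewrite mulrDl !mulrDr kk !mulrA kv !mul0r -!(mulrA _ u) uk mulr0.
  by rewrite addr0 add0r !mulrA -(mulrA _ u v) uv mulr1.
have := df _ _ (cE a) (cE b); rewrite !mE ab mulr1 kE addrC subrK => /(_ erefl).
rewrite -[RHS](subrK (v * u)) addrC => /addrI vbau; apply: ba.
rewrite -[b * a]mul1r -[1 * _]mulr1 -[in LHS]uv -2!mulrA (mulrA v) (mulrA (v * _)).
by rewrite vbau !mulrA uv mul1r uv.
Qed.

Lemma embed_purely_infinite (Q : pzRingType) (a b : Q) :
    purely_infinite Q -> a * b = 1 -> b * a <> 1 ->
  exists (T : pzRingType) (i : {rmorphism Q -> T}), injective i /\
    simple_ring T /\ right_self_injective T /\ VNR T /\ TypeIII T.
Proof.
move=> pi ab ba.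
have [T [i [inj_i dense_i]]] := max_quotient_ring (purely_infinite_nonsingular pi).
have piT := dense_extension_purely_infinite dense_i pi.
exists T, i; split=> //; split; [|split; [|split]].
- apply: purely_infinite_simple => //; rewrite -(rmorph1 i) -(rmorph0 i) => /inj_i one0.
  by apply: ba; rewrite -[LHS]mul1r -[RHS]mulr1 one0 !mul0r.
- exact: dense_extension_self_injective dense_i.
- exact: dense_extension_VNR dense_i.
- apply: (purely_infinite_typeIII (a := i a) (b := i b)) => //.
    by rewrite -rmorphM ab rmorph1.
  by rewrite -rmorphM -(rmorph1 i) => /inj_i.
Qed.

(** * Endomorphisms modulo small operators *)

Definition is_linear (F : pzRingType) (U W : lmodType F) (f : U -> W) : Prop :=
  forall c u v, f (c *: u + v) = c *: f u + f v.

Section Linear.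
Variables (F : pzRingType) (U W : lmodType F) (f : U -> W).
Hypothesis fL : is_linear f.

Lemma is_linear0 : f 0 = 0.
Proof. by have := fL (-1) 0 0; rewrite !scaleN1r !addNr. Qed.
Lemma is_linearZ c u : f (c *: u) = c *: f u.
Proof. by rewrite -[c *: u]addr0 fL is_linear0 addr0. Qed.
Lemma is_linearD u v : f (u + v) = f u + f v.
Proof. by rewrite -[u in LHS]scale1r fL scale1r. Qed.
Lemma is_linearN u : f (- u) = - f u.
Proof. by rewrite -scaleN1r is_linearZ scaleN1r. Qed.
Lemma is_linearB u v : f (u - v) = f u - f v.
Proof. by rewrite is_linearD is_linearN. Qed.
End Linear.

(** * Extension of linear maps over a field *)

Section FieldExtension.
Variables (F : fieldType).

(** Over a field compatibility costs nothing: a nonzero multiple of b in the domain already puts b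
    there, and otherwise any value allowed by [C] will do. *)
Lemma total_graph_field (B E : lmodType F) (G0 C : B -> E -> Prop) :
    linrel C -> between G0 C G0 -> (forall b, exists e, C b e) ->
  exists g : B -> E, is_linear g /\ (forall b, C b (g b)) /\
    (forall b e, G0 b e -> g b = e).
Proof.
move=> lC G0btw totC; apply: total_graph => // G [lG [fG [_ GC]]] b.
have [[e Ge]|ndom] := pselect (exists e, G b e).
  exists e; split=> [|r e' Gr]; first exact: GC.
  exact: functionalP lG fG Gr (linrelZ r lG Ge).
have [e Ce] := totC b; exists e; split=> // r e' Gr.
have [r0|r0] := eqVneq r 0.
  by rewrite r0 scale0r; apply: fG; rewrite -(scale0r b) -r0.
exfalso; apply: ndom; exists (r^-1 *: e').
by rewrite -[b](scalerK r0); apply: linrelZ.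
Qed.

Lemma linear_section (U W : lmodType F) (f : U -> W) : is_linear f ->
  (forall w, exists u, f u = w) -> exists2 y : W -> U, is_linear y & forall w, f (y w) = w.
Proof.
move=> fL fS.
have [|||y [yL [fy _]]] := @total_graph_field W U (fun w u => w = 0 /\ u = 0) (fun w u => f u = w);
  last by exists y.
- by split=> [|r w u w' u' <- <-]; [apply: is_linear0|apply: fL].
- split; [split=> // r w u w' u' [-> ->] [-> ->]|split; [|split=> //]].
  + by rewrite !scaler0 !addr0.
  + by move=> u [].
  + by move=> w u [-> ->]; apply: is_linear0.
- exact: fS.
Qed.

Lemma separating_form (U W : lmodType F) (f : U -> W) (w0 : W) : is_linear f ->
    ~ (exists u, f u = w0) ->
  exists g : W -> F^o, is_linear g /\ (forall u, g (f u) = 0) /\ g w0 = 1.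
Proof.
move=> fL nw0; pose G0 (w : W) (k : F^o) := exists u, w = f u + k *: w0.
have [|||g [gL [_ gG]]] := @total_graph_field W F^o G0 (fun _ _ => True); last first.
- exists g; split=> //; split=> [u|]; apply: gG.
    by exists u; rewrite scale0r addr0.
  by exists 0; rewrite (is_linear0 fL) add0r scale1r.
- by move=> b; exists 0.
- split; [split|split; [|split=> //]].
  + by exists 0; rewrite (is_linear0 fL) scale0r addr0.
  + move=> r _ k _ k' [u ->] [u' ->]; exists (r *: u + u').
    by rewrite fL scalerDr scalerDl scalerA addrACA.
  + move=> k [u /esym/eqP]; rewrite addr_eq0 => /eqP fu.
    apply/eqP/negPn/negP => k0; apply: nw0; exists (- k^-1 *: u).
    by rewrite (is_linearZ fL) fu scaleNr scalerN opprK scalerK.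
- by [].
Qed.

Lemma linear_projection (W : lmodType F) (K : W -> Prop) :
    K 0 -> (forall c u v, K u -> K v -> K (c *: u + v)) ->
  exists g : W -> W, is_linear g /\ (forall w, K (g w)) /\ (forall w, K w -> g w = w).
Proof.
move=> K0 KL; pose G0 (b e : W) := K b /\ e = b.
have [|||g [gL [Kg gG]]] := @total_graph_field W W G0 (fun _ e => K e); last first.
- by exists g; split=> //; split=> // w Kw; apply: gG.
- by move=> b; exists 0.
- split; [split=> // r b e b' e' [Kb ->] [Kb' ->]|split; [|split=> //]].
  + by split=> //; apply: KL.
  + by move=> e [].
  + by move=> b e [Kb ->].
- by split=> // r b e b' e'; apply: KL.
Qed.

End FieldExtension.

(** An infinite index set closed under pairing: [Node] embeds pairs of trees into trees, so the
    functions on trees map onto families, indexed by trees, of such functions. This replaces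
    cardinal arithmetic, and [Leaf] leaves room for the elements of [A]. *)
Inductive tree (A : Type) : Type := Leaf of A | Node of tree A & tree A.

Section Endomorphisms.
Variables (F : fieldType) (A : Type) (a0 : A).

Definition tree_space : lmodType F := (tree A -> F^o).
Local Notation V := tree_space.
Implicit Types p q x y : V -> V.

(* [small] operators play the role of those of rank less than the dimension. *)
Definition factors_id q := exists x y, is_linear x /\ is_linear y /\ forall v, x (q (y v)) = v.
Definition small q := ~ factors_id q.

Lemma opD p q v : (p + q) v = p v + q v. Proof. by []. Qed.
Lemma opN p v : (- p) v = - p v. Proof. by []. Qed.

Lemma is_linear_comp p q : is_linear p -> is_linear q -> is_linear (p \o q).
Proof. by move=> pL qL c u v /=; rewrite qL pL. Qed.

Lemma is_linear_zero : is_linear (0 : V -> V).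
Proof. by move=> c u v; rewrite scaler0 addr0. Qed.

Lemma is_linear_id : is_linear (id : V -> V). Proof. by []. Qed.

Lemma is_linear_add p q : is_linear p -> is_linear q -> is_linear (p + q).
Proof. by move=> pL qL c u v; rewrite !opD pL qL scalerDr addrACA. Qed.

Lemma is_linear_opp p : is_linear p -> is_linear (- p).
Proof. by move=> pL c u v; rewrite !opN pL scalerN opprD. Qed.

Lemma is_linear_scale c : is_linear (fun v : V => c *: v).
Proof. by move=> d u v; rewrite scalerDr !scalerA mulrC. Qed.

Lemma small0 : small 0.
Proof.
move=> [x [y [xL [_ xy]]]]; have := xy (fun _ => 1); rewrite (is_linear0 xL).
by move=> /(congr1 (fun v => v (Leaf a0)))/esym/eqP; apply/negP/oner_neq0.
Qed.

Lemma small_comp x q y : is_linear x -> is_linear y -> small q -> small (x \o q \o y).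
Proof.
move=> xL yL sq [x' [y' [x'L [y'L xy]]]]; apply: sq.
exists (x' \o x), (y \o y').
by split; [exact: is_linear_comp|split; [exact: is_linear_comp|]].
Qed.

Definition branch (s : tree A) : V -> V := fun v t => v (Node s t).

Lemma branch_linear s : is_linear (branch s). Proof. by []. Qed.

Lemma branch_glue (c : tree A -> V) : exists v : V, forall s, branch s v = c s.
Proof. by exists (fun t => if t is Node s t' then c s t' else 0). Qed.

Lemma small_surj x q : is_linear x -> is_linear q -> small q -> ~ (forall w, exists u, x (q u) = w).
Proof.
move=> xL qL sq /(linear_section (is_linear_comp xL qL))[y yL xqy].
by apply: sq; exists x, y.
Qed.

(* If no [branch s \o p] is onto, each is killed by a nonzero form; gluing these forms gives an
   operator which is onto and kills [p], hence agrees with itself composed with [q]. *)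
Lemma small_id p q : is_linear p -> is_linear q -> small p -> small q ->
  ~ (forall v, p v + q v = v).
Proof.
move=> pL qL sp sq pq.
have /choice[g gP] s : exists g : V -> F^o, is_linear g /\
    (forall u, g (branch s (p u)) = 0) /\ exists w, g w = 1.
  have [w] : exists w, ~ exists u, branch s (p u) = w.
    by have /existsNP[w] := small_surj (branch_linear s) pL sp; exists w.
  case/(separating_form (is_linear_comp (branch_linear s) pL)) => g [gL [gp gw]].
  by exists g; split=> //; split=> //; exists w.
have /choice[w gw] s : exists w, g s w = 1 by have [_ [_]] := gP s.
pose L (v : V) : V := fun s => g s (branch s v).
have LL : is_linear L.
  by move=> c u v; apply/funext => s; rewrite /L branch_linear (proj1 (gP s)).
apply: (small_surj LL qL sq) => c.
(* The branch of v at s is c(s) w(s), where the form at s takes the value 1 on w(s); hence L v =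
   c. *)
have [v vP] := branch_glue (fun s => c s *: w s); exists v; apply/funext => s.
have -> : q v = v - p v by apply/esym/eqP; rewrite subr_eq addrC pq.
rewrite (is_linearB LL) /L !addrfctE opprfctE (proj1 (proj2 (gP s))) subr0 vP.
by rewrite (is_linearZ (proj1 (gP s))) gw /GRing.scale/= mulr1.
Qed.

(** If x (p + q) y is the identity, then x p y and x q y are small operators with sum the identity,
    which [small_id] excludes. *)
Lemma small_add p q : is_linear p -> is_linear q -> small p -> small q -> small (p + q).
Proof.
move=> pL qL sp sq [x [y [xL [yL xy]]]].
have sL r : is_linear r -> is_linear (x \o r \o y).
  by move=> rL; do 2!apply: is_linear_comp => //.
apply: (small_id (sL p pL) (sL q qL)); try exact: small_comp.
by move=> v; rewrite -[RHS]xy /= -(is_linearD xL).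
Qed.

Definition endo := {f : V -> V | is_linear f}.
Definition endo_zero : endo := exist _ _ is_linear_zero.
Definition endo_one : endo := exist _ id is_linear_id.
Definition endo_opp (f : endo) : endo := exist _ _ (is_linear_opp (svalP f)).
Definition endo_add (f g : endo) : endo := exist _ _ (is_linear_add (svalP f) (svalP g)).
Definition endo_mul (f g : endo) : endo := exist _ _ (is_linear_comp (svalP f) (svalP g)).
Definition endo_scale c : endo := exist _ _ (is_linear_scale c).
Definition endo_eq (f g : endo) := small (sval f - sval g).

Lemma endo_eq_ext (f g : endo) : (forall v, sval f v = sval g v) -> endo_eq f g.
Proof. by move=> /funext fg; rewrite /endo_eq fg subrr; apply: small0. Qed.

Lemma endo_ring : ring_congruence endo_zero endo_one endo_opp endo_add endo_mul endo_eq.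
Proof.
have subL (f g : endo) : is_linear (sval f - sval g).
  by apply: is_linear_add; [apply: svalP|apply/is_linear_opp/svalP].
have smallN q : small q -> small (- q).
  by move=> sq; have := small_comp (is_linear_opp is_linear_id) is_linear_id sq.
split; try by move=> *; apply: endo_eq_ext => v;
  rewrite /= ?opD ?opN ?addrA ?add0r ?addNr //; rewrite addrC.
- by move=> f g /smallN; rewrite /endo_eq opprB.
- by move=> f g h fg gh; rewrite /endo_eq -(subrK (sval g) (sval f)) -addrA; apply: small_add.
- by move=> f g /smallN; rewrite /endo_eq opprB /= opprK addrC.
- move=> f f' g g' ff' gg'; rewrite /endo_eq /= opprD addrACA; exact: small_add.
- move=> f f' g g' ff' gg'; rewrite /endo_eq /=.
  have -> : (sval f \o sval g) - (sval f' \o sval g') =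
      (sval f \o (sval g - sval g')) + ((sval f - sval f') \o sval g').
    apply/funext => v; rewrite !(opD, opN) /= !(opD, opN).
    by rewrite (is_linearB (svalP f)) addrA subrK.
  apply: small_add.
  + by apply: is_linear_comp => //; apply: svalP.
  + by apply: is_linear_comp => //; apply: svalP.
  + by have := small_comp (svalP f) is_linear_id gg'.
  + by have := small_comp is_linear_id (svalP g') ff'.
- move=> f g h; apply: endo_eq_ext => v /=.
  by rewrite opD (is_linearD (svalP f)).
Qed.

Section Quotient.
Variables (Q : pzRingType) (p : endo -> Q).
Hypothesis pQ : is_quotient_ring endo_zero endo_one endo_opp endo_add endo_mul endo_eq p.

Lemma endo_quot_eq (f g : endo) : (forall v, sval f v = sval g v) -> p f = p g.
Proof. by case: pQ => _ [pE _] fg; apply/pE/endo_eq_ext. Qed.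

Lemma endo_quot_neq0 (f : endo) : p f <> 0 <-> factors_id (sval f).
Proof.
case: pQ => _ [pE [p0 _]]; rewrite -p0 pE /endo_eq /= subr0.
by split=> [/contrapT//|ff sf]; apply: sf.
Qed.

Lemma endo_quot_purely_infinite : purely_infinite Q.
Proof.
case: (pQ) => psurj [pE [p0 [p1 [pN [pD pM]]]]] q.
have [f <-] := psurj q; move=> /endo_quot_neq0[x [y [xL [yL xy]]]].
exists (p (exist _ x xL)), (p (exist _ y yL)); rewrite -!pM -p1.
exact: endo_quot_eq.
Qed.

(** Reading the branch at [s0] undoes [b0], which copies a vector into all branches indexed by
    leaves. The image of [b0] vanishes on branches indexed by nodes, so 1 - b a, preceded by [b1]
    and read at [s1], is the identity and is therefore not small. *)
Lemma endo_quot_infinite : exists a b : Q, a * b = 1 /\ b * a <> 1.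
Proof.
case: (pQ) => psurj [pE [p0 [p1 [pN [pD pM]]]]].
pose s0 := Leaf a0; pose s1 := Node s0 s0.
pose b0 (v : V) : V := fun t => if t is Node (Leaf _) t' then v t' else 0.
pose b1 (v : V) : V := fun t => if t is Node (Node _ _) t' then v t' else 0.
have b0L : is_linear b0.
  by move=> c u v; apply/funext => -[?|[?|? ?] ?]; rewrite /b0 !addrfctE !scalrfctE ?scaler0 ?addr0.
have b1L : is_linear b1.
  by move=> c u v; apply/funext => -[?|[?|? ?] ?]; rewrite /b1 !addrfctE !scalrfctE ?scaler0 ?addr0.
pose a := exist _ (branch s0) (@branch_linear s0) : endo.
pose b := exist _ b0 b0L : endo.
exists (p a), (p b); split; first by rewrite -pM -p1; apply: endo_quot_eq.
move/eqP; rewrite eq_sym -subr_eq0 -p1 -pM -pN -pD => /eqP; apply/endo_quot_neq0.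
exists (branch s1), b1; split; first exact: branch_linear.
by split=> // v; apply/funext => t; change (v t - 0 = v t); rewrite subr0.
Qed.

End Quotient.
End Endomorphisms.

(** * Additive maps to a prime field *)

Definition is_additive (U W : zmodType) (f : U -> W) : Prop :=
  forall a b, f (a + b) = f a + f b.

Section Representation.
Variables (F : fieldType) (R : pzRingType).
Local Notation V := (tree_space F R).
Local Notation endo := (endo F R).

(* [R] acts on the additive maps [R -> F] by [(r f)(a) = f (a r)]; [P] transports this action to
   all maps [R -> F], and [rep_fun] lets it act on infinitely many copies of them. *)
Lemma representation : exists psi : R -> endo,
  (forall r s v, sval (psi (r + s)) v = sval (psi r) v + sval (psi s) v) /\
  (forall r s v, sval (psi (r * s)) v = sval (psi r) (sval (psi s) v)) /\
  (forall r (f : R -> F), is_additive f -> f r = 1 -> factors_id (sval (psi r))).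
Proof.
pose W : lmodType F := (R -> F^o).
have [||P [PL [PK Pid]]] := @linear_projection F W (fun f => is_additive f).
- by move=> a b; rewrite addr0.
- move=> c f g fD gD a b; rewrite !addrfctE !scalrfctE fD gD.
  by rewrite scalerDr addrACA.
(* The copy of a map from [R] to [F] with index s is stored at the leaves of branch s. *)
pose res s (v : V) : W := fun a => v (Node s (Leaf a)).
have resL s : is_linear (res s) by [].
pose rep_fun r (v : V) : V := fun t => if t is Node s (Leaf a) then P (res s v) (a * r) else 0.
have repL r : is_linear (rep_fun r).
  move=> c u v; apply/funext => -[a|s [a|? ?]]; rewrite /rep_fun addrfctE scalrfctE ?scaler0 ?addr0 //.
  by rewrite resL PL.
exists (fun r => exist _ (rep_fun r) (repL r)); split; [|split] => /=.
- move=> r s v; apply/funext => -[a|t [a|? ?]]; rewrite /rep_fun addrfctE ?addr0 //.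
  by rewrite mulrDr PK.
- move=> r s v; apply/funext => -[a|t [a|? ?]]; rewrite /rep_fun //.
  (* The inner action yields a map that is already additive, so the outer projection fixes it. *)
  rewrite [in RHS]Pid ?mulrA // /res => b c.
  by rewrite mulrDl PK.
- move=> r f fD fr.
  (* The copy with index s receives v(s) f; after the action of r its value at 1 is v(s) f(r) =
     v(s), so evaluation at 1 recovers v. *)
  pose y (v : V) : V := fun t => if t is Node s (Leaf a) then v s * f a else 0.
  have yL : is_linear y.
    move=> c u v; apply/funext => -[a|s [a|? ?]]; rewrite /y !addrfctE !scalrfctE ?scaler0 ?addr0 //.
    by rewrite mulrDl /GRing.scale /= mulrA.
  exists (fun v t => v (Node t (Leaf 1))), y; split; first by [].
  split=> // v; apply/funext => t; rewrite /rep_fun Pid ?mul1r.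
    by rewrite /res /y fr mulr1.
  by move=> a b; rewrite /res /y fD mulrDr.
Qed.

End Representation.

(** * Additive forms with values in a field of given characteristic *)

Section AdditiveForm.
Variables (U : zmodType) (F : fieldType) (n : nat).
Hypothesis charF : forall k : int, (k%:~R == 0 :> F) = (n %| k)%Z.

(** The form is prescribed as k on k u + n a; the hypothesis on u makes this well defined, with n =
    0 standing for characteristic zero. It extends because a value at r b can be divided by r
    whenever r is nonzero in [F]. *)
Lemma additive_form (u : U) : (forall (k : int) a, u *~ k = a *+ n -> (n %| k)%Z) ->
  exists f : U -> F, is_additive f /\ f u = 1.
Proof.
move=> un; pose B : lmodType int := zmodule U; pose E : lmodType int := zmodule F.
pose G0 (b : B) (e : E) := exists (k : int) (a : U), b = u *~ k + a *+ n /\ e = k%:~R :> F.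
have [|||g [gL [_ gG]]] := @total_graph int B E G0 (fun _ _ => True); last first.
- exists g; split; last by apply: gG; exists 1, 0; rewrite mul0rn addr0.
  by move=> a b; have := gL 1 a b; rewrite !scale1r.
- move=> G [lG [fG [G0G _]]] b.
  have [[r [e' [r0 Gr]]]|tor] := pselect (exists (r : int) e', r%:~R != 0 :> F /\ G (r *: b) e').
    pose e : E := (e' : F) / r%:~R.
    exists e; split=> // s e2 Gs.
    have es : (s%:~R : F) * e' = r%:~R * e2.
      rewrite !mulrzl; apply: (functionalP lG fG (linrelZ s lG Gr)).
      by rewrite scalerA mulrC -scalerA; exact: (linrelZ r lG Gs).
    by apply: (mulIf r0); rewrite scalezrE -[(e : F) *~ s]mulrzl -mulrA divfK // es mulrC.
  (* Here every r with r b in the domain vanishes in [F], so r b is n times an element and [G0]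
     already sends it to 0. *)
  exists 0; split=> // r e' Gr; rewrite scaler0.
  have /eqP : r%:~R == 0 :> F by apply: contrapT => /negP r0; apply: tor; exists r, e'.
  move=> /eqP; rewrite charF => /dvdzP[q rq].
  apply: (functionalP lG fG Gr); apply: G0G; exists 0, (b *~ q).
  by split; rewrite ?mulr0z // add0r rq scalezrE mulrzA pmulrn.
- split; [split|split; [|split=> //]].
  + by exists 0, 0; rewrite mul0rn addr0.
  + move=> r _ _ _ _ [k [a [-> ->]]] [k' [a' [-> ->]]]; exists (r * k + k'), (a *~ r + a').
    rewrite !scalezrE mulrzDl mulrzDr mulrnDl; split.
      rewrite -mulrzA [k * r]mulrC !pmulrn -!(mulrzA a) [n%:Z * r]mulrC.
      by rewrite addrACA.
    by rewrite mulrzDr mulrC mulrzA.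
  + move=> e [k [a [/esym/eqP]]]; rewrite addr_eq0 -mulNrn => /eqP /un nk ->.
    by apply/eqP; rewrite charF.
- by [].
Qed.

End AdditiveForm.

(** That is, [F] is a prime field. *)
Definition integer_fractions (F : fieldType) : Prop :=
  forall c : F, exists k m : int, k%:~R <> 0 :> F /\ c * k%:~R = m%:~R.

Lemma prime_field_forms (R : pzRingType) (z : R) : (forall m, z ^+ m <> 0) ->
  exists F : fieldType, countable_type F /\ integer_fractions F /\
    forall m, exists f : R -> F, is_additive f /\ f (z ^+ m) = 1.
Proof.
move=> z0.
have [[p [p_pr zp]]|nzp] := pselect (exists p, prime p /\ forall m a, z ^+ m <> a *+ p).
  exists 'F_p; split; [|split].
  - by exists val; apply: val_inj.
  - move=> c; exists 1, (c : nat)%:Z; split; first exact/eqP/oner_neq0.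
    by rewrite mulr1 -[RHS]/((c : nat)%:R) natr_Zp.
  - move=> m; apply: (@additive_form _ _ p) => [k|k a za].
      by rewrite (dvdz_pcharf (pchar_Fp p_pr)).
    (* If p does not divide k, write v k + w p = 1; then k z^m = p a would give z^m = p (v a + w
       z^m). *)
    apply: contrapT => /negP npk; have [v [w vw]] := Bezoutz k p.
    apply: (zp m (a *~ v + z ^+ m *~ w)).
    have g1 : gcdz k p = 1.
      rewrite /gcdz; congr Posz; apply/eqP.
      by rewrite [_ == _]coprime_sym prime_coprime.
    rewrite mulrnDl -[LHS](mulr1z (z ^+ m)) -[in LHS]g1 -vw mulrzDr [v * k]mulrC (mulrzA _ k) za.
    by rewrite !pmulrn -!mulrzA [v * p]mulrC.
(* Otherwise every prime divides some power of z, and by splitting off the least prime divisor so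
   does every positive n. *)
have zn n : (0 < n)%N -> exists m a, z ^+ m = a *+ n.
  elim/ltn_ind: n => n IH n_gt0; have [n1|n1] := leqP n 1.
    by exists 0%N, 1; rewrite (_ : n = 1%N) //; apply/eqP; rewrite eqn_leq n1.
  have pn := pdiv_dvd n; have p_pr := pdiv_prime n1.
  have [||m [a za]] := IH (n %/ pdiv n)%N.
  - by rewrite ltn_Pdiv // prime_gt1.
  - by rewrite divn_gt0 ?pdiv_gt0 // dvdn_leq.
  have [m' [a' za']] : exists m a, z ^+ m = a *+ pdiv n.
    apply: contrapT => nex; apply: nzp; exists (pdiv n); split=> // m' a' za'.
    by apply: nex; exists m', a'.
  exists (m + m')%N, (a * a'); rewrite exprD za za' mulrnAl mulrnAr -mulrnA.
  by rewrite mulnC divnK.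
exists rat; split; [|split].
- by exists pickle; apply: pcan_inj pickleK.
- move=> c; exists (denq c), (numq c); rewrite numqE; split=> //.
  by apply/eqP; rewrite intr_eq0 denq_neq0.
- move=> m; apply: (@additive_form _ _ 0) => [k|k a]; first by rewrite intr_eq0 dvd0z.
  rewrite mulr0n dvd0z => zk; apply: contrapT => /negP k0.
  have [|m' [a' za']] := zn `|k|%N; first by rewrite absz_gt0.
  (* If k z^m = 0 with k nonzero, then z^(m' + m) is a' times |k| z^m, hence zero. *)
  apply: (z0 (m' + m)%N); rewrite exprD za' mulrnAl -mulrnAr.
  have -> : z ^+ m *+ `|k| = 0.
    move: zk; rewrite {1}(intEsign k) mulrC mulrzA -pmulrn.
    by case: (k < 0)%R; rewrite ?mulrN1z ?mulr1z // => /eqP; rewrite oppr_eq0 => /eqP.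
  by rewrite mulr0.
Qed.

(** * Local subrings generated by nil right ideals *)

Definition subring_pred (Q : pzRingType) (S : Q -> Prop) : Prop :=
  S 1 /\ (forall a b, S a -> S b -> S (a - b)) /\ (forall a b, S a -> S b -> S (a * b)).

(** The ring is built as the quotient of the subset type by equality of values, so the earlier
    construction supplies its structure. *)
Lemma subring_type (Q : pzRingType) (S : Q -> Prop) : subring_pred S ->
  exists (B : pzRingType) (phi : {rmorphism B -> Q}), injective phi /\
    forall q, S q <-> exists b, phi b = q.
Proof.
move=> [S1 [SB SM]]; pose A := {q | S q}.
have S0 : S 0 by rewrite -(subrr 1); apply: SB.
have SN a : S a -> S (- a) by rewrite -sub0r; apply: SB.
have SD a b : S a -> S b -> S (a + b) by move=> Sa /SN/(SB _ _ Sa); rewrite opprK.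
pose zero : A := exist _ 0 S0; pose one : A := exist _ 1 S1.
pose opp (a : A) : A := exist _ _ (SN _ (svalP a)).
pose add (a b : A) : A := exist _ _ (SD _ _ (svalP a) (svalP b)).
pose mul (a b : A) : A := exist _ _ (SM _ _ (svalP a) (svalP b)).
have cg : ring_congruence zero one opp add mul (fun a b => sval a = sval b).
  split; rewrite /=.
  - by [].
  - by move=> a b ->.
  - by move=> a b c -> ->.
  - by move=> a b ->.
  - by move=> a a' b b' -> ->.
  - by move=> a a' b b' -> ->.
  - by move=> a b c; rewrite addrA.
  - by move=> a b; rewrite addrC.
  - by move=> a; rewrite add0r.
  - by move=> a; rewrite addNr.
  - by move=> a b c; rewrite mulrA.
  - by move=> a; rewrite mul1r.
  - by move=> a; rewrite mulr1.
  - by move=> a b c; rewrite mulrDl.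
  - by move=> a b c; rewrite mulrDr.
have [B [p [psurj [pE [p0 [p1 [pN [pD pM]]]]]]]] := quotient_ring cg.
have /choice[r rK] b := psurj b.
have hE a : sval (r (p a)) = sval a by apply/pE.
have [||a b|phi phiE] := @rmorphism_pack B Q (fun b => sval (r b)).
- by move=> a b; rewrite -{1}(rK a) -{1}(rK b) -pN -pD hE.
- by rewrite -p1 hE.
- by rewrite -{1}(rK a) -{1}(rK b) -pM hE.
exists B, phi; split=> [a b|q].
  by rewrite !phiE => /pE; rewrite !rK.
split=> [Sq|[b <-]]; last by rewrite phiE; apply: svalP.
by exists (p (exist _ q Sq)); rewrite phiE hE.
Qed.

Lemma nilpotent_inverse (B : pzRingType) (u : B) : nilpotent_el u ->
  exists v, (1 - u) * v = 1 /\ v * (1 - u) = 1.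
Proof.
move=> [n un]; exists (\sum_(j < n) u ^+ j).
have uE : (1 - u) * (\sum_(j < n) u ^+ j) = 1.
  by apply: oppr_inj; rewrite -mulNr opprB -subrX1 un sub0r.
split=> //; rewrite -[RHS]uE; apply: commr_sym; apply: commr_sum => j _.
by apply: commrX; apply: commr_sym; apply: commrB => //; apply: commr1.
Qed.

Section NilGenerated.
Variables (B : pzRingType) (x y : B).
Hypotheses (xnil : forall b, nilpotent_el (x * b)) (ynil : forall b, nilpotent_el (y * b)).

Let M b := exists a a', b = x * a + y * a'.

(* With [u] the inverse of [1 - x a], [1 - x a - y a' = (1 - y a' u) (1 - x a)]. *)
Lemma nil_sum_quasiregular m : M m -> exists v, (1 - m) * v = 1.
Proof.
move=> [a [a' ->]]; have [u [xu ux]] := nilpotent_inverse (xnil a).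
have [w [yw _]] := nilpotent_inverse (ynil (a' * u)).
have -> : 1 - (x * a + y * a') = (1 - y * (a' * u)) * (1 - x * a).
  by rewrite mulrBl mul1r -!mulrA ux mulr1 opprD addrA.
by exists (u * w); rewrite -mulrA (mulrA _ u w) xu mul1r.
Qed.

(** If b = c + m lies outside [M], then c has an inverse d and b d = 1 + m d is right invertible. So
    every proper right ideal lies in [M], which is itself proper. *)
Lemma local_ring_nil_sum (C : B -> Prop) : (1 : B) <> 0 ->
    (forall c, C c -> c = 0 \/ exists d, d * c = 1 /\ c * d = 1) ->
    (forall b, exists c m, C c /\ M m /\ b = c + m) ->
  local_ring B.
Proof.
move=> one0 Cunit BE.
have rM : right_ideal M.
  split; [|split; [|split]].
  - by exists 0, 0; rewrite !mulr0 addr0.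
  - by move=> _ _ [a [b ->]] [a' [b' ->]]; exists (a + a'), (b + b'); rewrite !mulrDr addrACA.
  - by move=> _ [a [b ->]]; exists (- a), (- b); rewrite !mulrN opprD.
  - by move=> _ r [a [b ->]]; exists (a * r), (b * r); rewrite mulrDl !mulrA.
have nM1 : ~ M 1.
  by move=> /nil_sum_quasiregular[v]; rewrite subrr mul0r => /esym.
have unit_notin b : ~ M b -> exists v, b * v = 1.
  move=> nMb; have [c [m [Cc [Mm bE]]]] := BE b.
  have [c0|[d [dc cd]]] := Cunit c Cc; first by case: nMb; rewrite bE c0 add0r.
  have [|v vE] := @nil_sum_quasiregular (- (m * d)).
    by apply: right_idealN => //; apply: right_idealM.
  rewrite opprK in vE; exists (d * v).
  by rewrite bE mulrA mulrDl cd.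
have notin_unit N b v : maximal_right_ideal N -> b * v = 1 -> ~ N b.
  by move=> [rN [N1 _]] bv Nb; apply: N1; rewrite -bv; apply: right_idealM.
exists M; split.
  split=> //; split=> // N rN MN.
  have [[b [Nb nMb]]|NM] := pselect (exists b, N b /\ ~ M b).
    right=> b'; have [v bv] := unit_notin b nMb.
    by rewrite -(mul1r b') -bv -mulrA; apply: right_idealM.
  left=> b; split=> [Nb|]; last exact: MN.
  by apply: contrapT => nMb; apply: NM; exists b.
move=> N mN; have NM b : N b -> M b.
  move=> Nb; apply: contrapT => /unit_notin[v bv].
  exact: notin_unit mN bv Nb.
case: mN => rN [_ mN] b; have [MN|MT] := mN M rM NM; first by rewrite MN.
by case: nM1.
Qed.

End NilGenerated.

(** * The algebra generated by two elements over a central field *)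

Section GeneratedAlgebra.
Variables (Q : pzRingType) (F : fieldType) (kap : {rmorphism F -> Q}).
Hypothesis kapC : forall c q, kap c * q = q * kap c.
Variables x y : Q.

Definition word (w : seq bool) : Q := \prod_(b <- w) (if b then x else y).
(** Noncommutative polynomials are finite lists of coefficients and words, which makes the generated
    algebra visibly countable when [F] is. *)
Definition nc_eval (s : seq (F * seq bool)) : Q := \sum_(m <- s) kap m.1 * word m.2.
Definition generated (q : Q) : Prop := exists s, nc_eval s = q.

Lemma generated_ind (P : Q -> Prop) : P 0 ->
    (forall c w q, P q -> P (kap c * word w + q)) ->
  forall q, generated q -> P q.
Proof.
move=> P0 Padd _ [s <-]; rewrite /nc_eval; elim: s => [|[c w] s IH].
  by rewrite big_nil.
by rewrite big_cons; apply: Padd.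
Qed.

Lemma generatedD a b : generated a -> generated b -> generated (a + b).
Proof. by move=> [s <-] [t <-]; exists (s ++ t); rewrite /nc_eval big_cat. Qed.

Lemma generated_monomial c w : generated (kap c * word w).
Proof. by exists [:: (c, w)]; rewrite /nc_eval big_seq1. Qed.

Lemma generated0 : generated 0.
Proof. by exists [::]; rewrite /nc_eval big_nil. Qed.

Lemma wordM u w : word u * word w = word (u ++ w).
Proof. by rewrite /word big_cat. Qed.

Lemma word_nil : word [::] = 1. Proof. by rewrite /word big_nil. Qed.

Lemma word_cons b w : word (b :: w) = (if b then x else y) * word w.
Proof. by rewrite /word big_cons. Qed.

Lemma generatedM a b : generated a -> generated b -> generated (a * b).
Proof.
move=> ga gb; move: a ga; apply: generated_ind => [|c w q gq].
  by rewrite mul0r; apply: generated0.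
rewrite mulrDl; apply: generatedD => //.
move: b gb {gq}; apply: generated_ind => [|d u r gr].
  by rewrite mulr0; apply: generated0.
rewrite mulrDr; apply: generatedD => //.
rewrite -mulrA (mulrA (word w)) -kapC !mulrA -rmorphM -mulrA wordM.
exact: generated_monomial.
Qed.

Lemma generated_const c : generated (kap c).
Proof. by rewrite -[kap c]mulr1 -word_nil; apply: generated_monomial. Qed.

Lemma generated_gen (b : bool) : generated (if b then x else y).
Proof.
rewrite -[X in generated X]mul1r -(rmorph1 kap) -[X in _ * X]mulr1 -word_nil -word_cons.
exact: generated_monomial.
Qed.

Lemma generated_subring : subring_pred generated.
Proof.
split; first by rewrite -(rmorph1 kap); apply: generated_const.
split=> [a b ga gb|]; last exact: generatedM.
apply: generatedD => //; rewrite -mulN1r -(rmorph1 kap) -rmorphN.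
by apply: generatedM => //; apply: generated_const.
Qed.

(** Empty words make up the constant; every other word goes to the x or the y summand according to
    its first letter. *)
Lemma generated_split q : generated q ->
  exists c a b, generated a /\ generated b /\ q = kap c + (x * a + y * b).
Proof.
move: q; apply: generated_ind.
  exists 0, 0, 0; rewrite rmorph0 !mulr0 !addr0.
  by split; [exact: generated0|split; [exact: generated0|]].
move=> c [|[] w] q [c' [a [b [ga [gb ->]]]]].
- exists (c + c'), a, b; do 2!split=> //.
  by rewrite word_nil mulr1 rmorphD addrA.
- exists c', (kap c * word w + a), b; split; last split=> //.
    by apply: generatedD => //; apply: generated_monomial.
  by rewrite word_cons mulrA kapC -mulrA mulrDr addrCA !addrA kapC.
- exists c', a, (kap c * word w + b); split=> //; split.
    by apply: generatedD => //; apply: generated_monomial.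
  by rewrite word_cons mulrA kapC -mulrA mulrDr addrCA (addrCA (x * a)) kapC.
Qed.

Hypothesis ratF : integer_fractions F.
Variables (R : pzRingType) (h : R -> Q).
Hypotheses (hD : forall r s, h (r + s) = h r + h s) (hM : forall r s, h (r * s) = h r * h s).

Lemma nonunital0 : h 0 = 0.
Proof. by apply: (addrI (h 0)); rewrite -hD !addr0. Qed.

Lemma nonunitalZ r (k : int) : h (r *~ k) = kap k%:~R * h r.
Proof.
have hn (n : nat) : h (r *+ n) = h r *+ n.
  by elim: n => [|n IH]; rewrite ?mulr0n ?nonunital0 // !mulrS hD IH.
have hN s : h (- s) = - h s.
  by apply: (addrI (h s)); rewrite -hD !subrr nonunital0.
rewrite rmorph_int mulrzl; case: k => n; first by rewrite -!pmulrn.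
by rewrite !NegzE !mulrNz hN -!pmulrn hn.
Qed.

Variables (x0 y0 : R).
Hypotheses (hx : h x0 = x) (hy : h y0 = y).

(** Since h need not send 1 to 1, the constant term of q may fall outside its image; the left factor
    h(t) absorbs it. *)
Lemma clear_denominators q : generated q ->
  exists k : int, k%:~R <> 0 :> F /\ exists r, forall t, h t * q * kap k%:~R = h (t * r).
Proof.
have hw w : exists r, forall t, h t * word w = h (t * r).
  elim: w => [|b w [r rP]]; first by exists 1 => t; rewrite word_nil !mulr1.
  exists ((if b then x0 else y0) * r) => t.
  by rewrite word_cons mulrA -[if b then x else y](_ : h (if b then x0 else y0) = _) -?hM ?rP ?mulrA //; case: b.
move: q; apply: generated_ind.
  by exists 1; split; [exact/eqP/oner_neq0|exists 0 => t; rewrite !mulr0 mul0r nonunital0].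
move=> c w q [k [/eqP k0 [r rP]]]; have [k' [m [/eqP k'0 ck']]] := ratF c.
have [s sP] := hw w; exists (k * k'); split.
  by apply/eqP; rewrite intrM mulf_neq0.
(* With c = m / k', and r the numerator of q over k, this is the numerator over the common
   denominator k k'. *)
exists (s *~ (m * k) + r *~ k') => t.
rewrite !mulrDr hD mulrDl !mulrzAr !nonunitalZ -rP -sP !intrM; congr (_ + _).
  rewrite -ck' [RHS]kapC [kap c * _]kapC mulrA -(mulrA _ (kap c)) -rmorphM.
  by rewrite [k%:~R * _]mulrC mulrA.
by rewrite rmorphM mulrA [RHS]kapC.
Qed.

Lemma generated_nil : (forall r, nilpotent_el (x0 * r)) ->
  forall q, generated q -> nilpotent_el (x * q).
Proof.
move=> xnil q /clear_denominators[k [/eqP k0 [r rP]]].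
(* The exponent is raised by one because h transports only positive powers. *)
have [n xrn] := xnil r; exists n.+1.
have hX a m : h (a ^+ m.+1) = h a ^+ m.+1.
  by elim: m => [|m IH]; rewrite ?expr1 // !(exprS _ m.+1) hM IH.
have : (x * q * kap k%:~R) ^+ n.+1 = 0.
  by rewrite -hx rP -hX exprS xrn mulr0 nonunital0.
rewrite exprMn_comm; last by rewrite /GRing.comm kapC.
move=> /(congr1 (fun u => u * kap (k%:~R ^- n.+1))).
by rewrite -rmorphXn -mulrA -rmorphM mulfV ?expf_neq0 // rmorph1 mulr1 mul0r.
Qed.

End GeneratedAlgebra.

Lemma local_NK_subring (Q : pzRingType) (F : fieldType) (kap : {rmorphism F -> Q})
    (R : pzRingType) (h : R -> Q) (x y : R) :
    (forall c q, kap c * q = q * kap c) -> countable_type F -> integer_fractions F ->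
    (forall r s, h (r + s) = h r + h s) -> (forall r s, h (r * s) = h r * h s) ->
    (forall r, nilpotent_el (x * r)) -> (forall r, nilpotent_el (y * r)) ->
    (forall m, h ((x + y) ^+ m) <> 0) ->
  exists (B : pzRingType) (phi : {rmorphism B -> Q}),
    injective phi /\ countable_type B /\ local_ring B /\ NK B.
Proof.
move=> kapC [enum enum_inj] ratF hD hM xnil ynil z0.
pose S := generated kap (h x) (h y).
have [B [phi [phi_inj phiS]]] := subring_type (generated_subring kapC (h x) (h y)).
have Sphi b : S (phi b) by apply/phiS; exists b.
have [X phiX] : exists b, phi b = h x by apply/phiS/(generated_gen _ _ _ true).
have [Y phiY] : exists b, phi b = h y by apply/phiS/(generated_gen _ _ _ false).
have nil_phi b : nilpotent_el (phi b) -> nilpotent_el b.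
  by move=> [n bn]; exists n; apply: phi_inj; rewrite rmorphXn bn rmorph0.
have Xnil b : nilpotent_el (X * b).
  apply: nil_phi; rewrite rmorphM phiX.
  exact: (generated_nil kapC ratF hD hM (erefl _) (erefl (h y)) xnil (Sphi b)).
have Ynil b : nilpotent_el (Y * b).
  apply: nil_phi; rewrite rmorphM phiY.
  have [s sP] := Sphi b.
  apply: (generated_nil kapC ratF hD hM (erefl _) (erefl (h x)) ynil).
  (* Exchanging the two letters in every word reduces the case of y to that of x. *)
  exists [seq (m.1, map negb m.2) | m <- s]; rewrite -sP /nc_eval big_map.
  apply: eq_bigr => m _; congr (_ * _); rewrite /word big_map.
  by apply: eq_bigr => b' _; case: b'.
have XYnil : ~ nilpotent_el (X + Y).
  move=> [n XYn]; have hX a m : h (a ^+ m.+1) = h a ^+ m.+1.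
    by elim: m => [|m IH]; rewrite ?expr1 // !(exprS _ m.+1) hM IH.
  apply: (z0 n.+1); rewrite hX hD -phiX -phiY -rmorphD -rmorphXn exprS XYn.
  by rewrite mulr0 rmorph0.
exists B, phi; split=> //; split; [|split].
(* Each element is coded by a chosen polynomial representing it. *)
- have /choice[code codeP] b := Sphi b.
  pose enc (s : seq (F * seq bool)) := pickle [seq (enum m.1, m.2) | m <- s].
  exists (enc \o code) => a b /(pcan_inj pickleK)/inj_map ab.
  apply: phi_inj; rewrite -!codeP ab // => -[c u] [d v] [/enum_inj -> ->].
  by [].
- apply: (@local_ring_nil_sum B X Y Xnil Ynil (fun b => exists c, phi b = kap c)).
  + move=> one0; apply: XYnil; exists 1%N.
    by rewrite expr1 -[LHS]mul1r one0 mul0r.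
  + move=> b [c bc]; have [c0|c0] := eqVneq c 0.
      by left; apply: phi_inj; rewrite bc c0 !rmorph0.
    right; have [d dc] : exists d, phi d = kap c^-1 by apply/phiS/generated_const.
    exists d; split; apply: phi_inj; rewrite rmorphM bc dc -rmorphM rmorph1.
      by rewrite mulVf // rmorph1.
    by rewrite mulfV // rmorph1.
  + move=> b; have [c [q [r [Sq [Sr bE]]]]] := generated_split kapC (Sphi b).
    have [a aE] : exists a, phi a = q by apply/phiS.
    have [a' aE'] : exists a, phi a = r by apply/phiS.
    have [d dE] : exists d, phi d = kap c by apply/phiS/generated_const.
    exists d, (X * a + Y * a'); split; first by exists c.
    split; first by exists a, a'.
    by apply: phi_inj; rewrite bE !rmorphD !rmorphM phiX phiY aE aE' dE.
- have ideal_gen (w : B) : right_ideal (fun b => exists a, b = w * a).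
    split; [|split; [|split]].
    + by exists 0; rewrite mulr0.
    + by move=> _ _ [a ->] [a' ->]; exists (a + a'); rewrite mulrDr.
    + by move=> _ [a ->]; exists (- a); rewrite mulrN.
    + by move=> _ r [a ->]; exists (a * r); rewrite mulrA.
  exists (fun b => exists a, b = X * a), (fun b => exists a, b = Y * a).
  split=> //; split=> //; split; first by move=> _ [a ->].
  split; first by move=> _ [a ->].
  move=> nil; apply/XYnil/nil; exists X, Y.
  by split; first exists 1; rewrite ?mulr1 //; split=> //; exists 1; rewrite mulr1.
Qed.

Lemma NK_generators (R : pzRingType) : NK R -> exists x y : R,
  (forall r, nilpotent_el (x * r)) /\ (forall r, nilpotent_el (y * r)) /\
  forall m, (x + y) ^+ m <> 0.
Proof.
move=> [I [J [rI [rJ [nI [nJ nIJ]]]]]].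
have /existsNP[z /not_implyP[[x [y [Ix [Jy ->]]]] nz]] := nIJ.
exists x, y; split=> [r|]; first by apply: nI; apply: right_idealM.
split=> [r|m xym]; first by apply: nJ; apply: right_idealM.
by apply: nz; exists m.
Qed.

(* A countable subring B of T is given as a countable ring B together with an
   injective (unital) ring morphism B -> T. *)
Theorem mainTheorem11 :
  (exists R : pzRingType, NK R) ->
  exists (T : pzRingType),
    simple_ring T /\ right_self_injective T /\ VNR T /\ (TypeII_f T \/ TypeIII T) /\
    exists (B : pzRingType) (phi : {rmorphism B -> T}),
      injective phi /\ countable_type B /\ local_ring B /\ NK B.
Proof.
move=> [R /NK_generators[x [y [xnil [ynil z0]]]]].
have [F [cF [ratF forms]]] := prime_field_forms z0.
have [psi [psiD [psiM psi1]]] := representation F R.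
(* Trees have leaves labelled by [R]; the element 1 only witnesses that labels exist. *)
have [Q [p pQ]] := quotient_ring (endo_ring F (1 : R)).
case: (pQ) => _ [_ [_ [p1 [pN [pD pM]]]]].
have eqp (f g : endo F R) : (forall v, sval f v = sval g v) -> p f = p g.
  exact: (endo_quot_eq (1 : R) pQ).
have [a [b [ab ba]]] := endo_quot_infinite (1 : R) pQ.
have [T [i [inj_i [sT [siT [vT tT]]]]]] :=
  embed_purely_infinite (endo_quot_purely_infinite (1 : R) pQ) ab ba.
exists T; do 3!split=> //; split; first by right.
(* Scalars act as multiplication operators, which are central because all operators are
   [F]-linear. *)
have [||c d|kap kapE] := @rmorphism_pack F Q (fun c => p (endo_scale R c)).
- by move=> c d; rewrite -pN -pD; apply: eqp => v; apply: scalerBl.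
- by rewrite -p1; apply: eqp => v; apply: scale1r.
- by rewrite -pM; apply: eqp => v; rewrite /= scalerA.
have [||||B [phi [inj_phi [cB [lB nB]]]]] :=
  @local_NK_subring Q F kap R (fun r => p (psi r)) x y _ cF ratF _ _ xnil ynil.
- move=> c q; have [f <-] : exists f, p f = q by case: pQ.
  by rewrite kapE -!pM; apply: eqp => v; rewrite /= (is_linearZ (svalP f)).
- by move=> r s; rewrite -pD; apply: eqp => v; apply: psiD.
- by move=> r s; rewrite -pM; apply: eqp => v; apply: psiM.
- by move=> m; have [f [fD f1]] := forms m; apply/(endo_quot_neq0 pQ)/(psi1 _ f).
by exists B, (i \o phi : {rmorphism B -> T}); split; first exact: inj_comp.
Qed.
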